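(* For any zero-dimensional frame $L$, the following are equivalent. (1) $L$ is $BD_0$. (2) $L$ is $CL$-basic (that is, $CL$ is a $\sigma$-frame). (3) $CL=D_\sigma CL=\mathfrak{B}L_\sigma$. (4) $CL$ is a $\sigma$-complete Boolean algebra. (5) The embedding of $CL$ into $L_\sigma$ has a left adjoint.
   Context: For a frame $L$, $a^*$ denotes the pseudocomplement of $a$ and $CL$ the Boolean algebra of complemented elements. $L$ is zero-dimensional if every element is a join of elements of $CL$. A $\sigma$-frame is a bounded lattice with countable joins in which binary meets distribute over countable joins. $L_\sigma$ is the sub-$\sigma$-frame of $L$ generated by $CL$, i.e. the set of countable joins in $L$ of elements of $CL$. For $S\subseteq L$, $\mathfrak{B}S=\{s^{**}:s\in S\}$. $L$ is $BD_0$ if $a^*\vee a^{**}=1$ for all $a\in L_\sigma$, equivalently $\mathfrak{B}L_\sigma=CL$. ''$CL$ is a $\sigma$-frame'' refers to $CL$ in its own order. For a meet-semilattice $A$, a subset $G\subseteq A$ is admissible if $\bigvee G$ exists in $A$ and for each $a\in A$ the join $\bigvee\{a\wedge y:y\in G\}$ exists in $A$ and equals $a\wedge\bigvee G$; a downset $E$ of $A$ is a D-ideal if $\bigvee G\in E$ for each admissible $G\subseteq E$; $D_\infty A$ is the frame of D-ideals under inclusion. When $A$ is a base of $L$ closed under binary meets, $D_\infty A$ is identified with the sublocale $\{x\in L:\{a\in A:a\le x\}\text{ is a D-ideal of }A\}$ of $L$ (which contains $A$). $D_\sigma CL$ is the sub-$\sigma$-frame of $D_\infty CL$ generated by $CL$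 (countable joins taken in $D_\infty CL$). *)

(* Defs.v *)
From HB Require Import structures.
From mathcomp Require Import all_boot all_order.
From mathcomp Require Import boolp classical_sets functions cardinality.

Set Implicit Arguments.
Unset Strict Implicit.
Unset Printing Implicit Defensive.

Import Order.Theory.

Local Open Scope classical_set_scope.
Local Open Scope order_scope.

(* Binary distributivity follows from [meet_fsup]; it is part of the base
   structure only so that the distributive lattice theory applies. *)
HB.mixin Record TBDistrLattice_isFrame d (L : Type)
    of Order.TBDistrLattice d L := {
  fsup : set L -> L;
  fsup_isLub : forall S : set L, isLub S (fsup S);
  meet_fsup : forall (a : L) (S : set L),
    a `&` fsup S = fsup [set a `&` s | s in S]
}.

#[short(type="frameType")]
HB.structure Definition Frame d :=
  {L of Order.TBDistrLattice d L & TBDistrLattice_isFrame d L}.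

Section FrameTheory.
Context {d : Order.disp_t} {L : frameType d}.
Implicit Types (a b x y : L) (S : set L).

Lemma fsup_ge S x : S x -> x <= fsup S.
Proof. by have [+ _] := fsup_isLub S; apply. Qed.

Lemma fsup_le S x : (forall s, S s -> s <= x) -> fsup S <= x.
Proof. by have [_ +] := fsup_isLub S; apply. Qed.

Lemma isLub_fsup S x : isLub S x -> x = fsup S.
Proof.
move=> [Sx xS]; apply/le_anti/andP; split; last exact: fsup_le.
by apply: xS => s; apply: fsup_ge.
Qed.

Definition pcompl a : L := fsup [set x | a `&` x = \bot].

Lemma meet_pcompl a : a `&` pcompl a = \bot.
Proof.
apply/eqP; rewrite -lex0 meet_fsup; apply: fsup_le => _ [x /= ax <-].
by rewrite ax.
Qed.

Lemma le_pcompl a x : (x <= pcompl a) = (a `&` x == \bot).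
Proof.
apply/idP/eqP => [xa|]; last exact: fsup_ge.
by apply/eqP; rewrite -lex0 -(meet_pcompl a) leI2.
Qed.

Definition complemented a := exists b, a `&` b = \bot /\ a `|` b = \top.

End FrameTheory.

Notation "a ^*" := (pcompl a) : order_scope.

Section Complemented.
Context {d : Order.disp_t}.
Variable L : frameType d.

Definition CL : set L := [set a | complemented a].

Lemma CL_pcomplP (a : L) : CL a <-> a `|` a^* = \top.
Proof.
split=> [[b [ab0 ab1]]|a1]; last by exists (a^*); rewrite meet_pcompl.
apply/eqP; rewrite -le1x -ab1 leU2// le_pcompl; exact/eqP.
Qed.

Lemma CL0 : CL \bot. Proof. by exists \top; rewrite meet0x join0x. Qed.
Lemma CL1 : CL \top. Proof. by exists \bot; rewrite meetx0 joinx0. Qed.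

Lemma CLI a b : CL a -> CL b -> CL (a `&` b).
Proof.
move=> [a' [aI aU]] [b' [bI bU]]; exists (a' `|` b'); split.
  by rewrite meetUr meetAC aI meet0x -meetA bI meetx0 joinxx.
by rewrite joinIl joinA aU join1x (joinC a') joinA bU join1x meetxx.
Qed.

Lemma CLC a : CL a -> CL (a^*).
Proof.
by move=> /CL_pcomplP a1; exists a; rewrite meetC joinC meet_pcompl.
Qed.

Lemma CLU a b : CL a -> CL b -> CL (a `|` b).
Proof.
move=> [a' [aI aU]] [b' [bI bU]]; exists (a' `&` b'); split.
  by rewrite meetUl meetA aI meet0x (meetC a') meetA bI meet0x joinxx.
by rewrite joinIr -joinA (joinC b) joinA aU join1x -joinA bU joinx1 meetxx.
Qed.

Record CL_type := MkCL { CL_val :> L; CL_valP : CL_val \in CL }.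
HB.instance Definition _ := [isSub for CL_val].
HB.instance Definition _ := [Choice of CL_type by <:].

Let CL_meet_closed : meet_closed (mem CL : {pred L}).
Proof. by move=> a b /set_mem Ca /set_mem Cb; apply/mem_set/CLI. Qed.
Let CL_join_closed : join_closed (mem CL : {pred L}).
Proof. by move=> a b /set_mem Ca /set_mem Cb; apply/mem_set/CLU. Qed.

HB.instance Definition _ :=
  Order.SubChoice_isTBSubLattice.Build d L (mem CL) d CL_type
    CL_meet_closed CL_join_closed (mem_set CL0) (mem_set CL1).


Lemma CL_valI (a b : CL_type) : CL_val (a `&` b) = CL_val a `&` CL_val b.
Proof. by []. Qed.
Lemma CL_valU (a b : CL_type) : CL_val (a `|` b) = CL_val a `|` CL_val b.
Proof. by []. Qed.
Lemma CL_val0 : CL_val \bot = \bot. Proof. by []. Qed.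
Lemma CL_val1 : CL_val \top = \top. Proof. by []. Qed.
Lemma CL_le_val (a b : CL_type) : (CL_val a <= CL_val b) = (a <= b).
Proof. by []. Qed.

Let CL_meetUl : @left_distributive CL_type CL_type Order.meet Order.join.
Proof. by move=> a b c; apply: val_inj; rewrite /= meetUl. Qed.

HB.instance Definition _ :=
  Order.Lattice_Meet_isDistrLattice.Build d CL_type CL_meetUl.

Definition CL_compl (c : CL_type) : CL_type :=
  MkCL (mem_set (CLC (set_mem (CL_valP c)))).

Let CL_joinxC c : c `|` CL_compl c = \top.
Proof. exact/val_inj/CL_pcomplP/set_mem/CL_valP. Qed.

Let CL_meetxC c : c `&` CL_compl c = \bot.
Proof. exact/val_inj/meet_pcompl. Qed.

HB.instance Definition _ :=
  Order.TBDistrLattice_hasComplement.Build d CL_type CL_joinxC CL_meetxC.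

End Complemented.

Arguments CL {d} L _.

Definition zero_dimensional {d} (L : frameType d) :=
  forall x : L, exists2 S : set L, S `<=` CL L & x = fsup S.

Section SubSigmaFrame.
Context {d : Order.disp_t} {L : frameType d}.
Implicit Types (P S X : set L) (x : L).

Definition isLub_in P S x :=
  [/\ P x, ubound S x & forall y, P y -> ubound S y -> x <= y].

Lemma isLub_inT S x : isLub_in setT S x <-> isLub S x.
Proof.
by split=> [[_ Sx xS]|[Sx xS]]; [split=> // y; apply: xS|split=> // y _; apply: xS].
Qed.

(* [P] is a sublocale of [L]: its finite meets are those of [L], but its joins
   are computed in [P]. The bottom element of [P] is the empty join. *)
Definition sub_sigma_frame P X :=
  [/\ X `<=` P,
      X \top,
      forall a b, X a -> X b -> X (a `&` b)
    & forall S x, countable S -> S `<=` X -> isLub_in P S x -> X x].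

Definition gen_sigma_frame P G : set L := smallest (sub_sigma_frame P) G.

Definition Boolz S : set L := [set s^*^* | s in S].

End SubSigmaFrame.

Section Lsigma.
Context {d : Order.disp_t}.
Variable L : frameType d.

Definition Lsigma : set L := gen_sigma_frame setT (CL L).

Lemma CL_sub_Lsigma : CL L `<=` Lsigma.
Proof. exact: sub_gen_smallest. Qed.

Lemma LsigmaE :
  Lsigma = [set x | exists S, [/\ countable S, S `<=` CL L & x = fsup S]].
Proof.
apply/seteqP; split; last first.
  move=> x [S [cS SC ->]] X [[_ _ _ XU] CX]; apply: (XU S) => //.
    exact: subset_trans CX.
  exact/isLub_inT/fsup_isLub.
have C1 a : CL L a -> exists S, [/\ countable S, S `<=` CL L & a = fsup S].
  move=> Ca; exists [set a]; split=> [|_ -> //|]; first exact: countable1.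
  by apply/isLub_fsup; split=> [_ ->//|b]; apply.
apply: smallest_sub => //; split=> //; first exact/C1/CL1.
  move=> _ _ [S [cS SC ->]] [T [cT TC ->]].
  exists [set s `&` t | s in S & t in T]; split.
    by rewrite image2E; apply: (sub_countable (card_image_le _ _)); apply: countableX.
    by move=> _ [s Ss] [t Tt] <-; apply: CLI; [apply: SC|apply: TC].
  apply/isLub_fsup; split=> [_ [s Ss] [t Tt] <-|b ub].
    by rewrite leI2// fsup_ge.
  rewrite meet_fsup; apply: fsup_le => _ [t Tt <-].
  rewrite meetC meet_fsup; apply: fsup_le => _ [s Ss <-].
  by rewrite meetC; apply: ub; exists s => //; exists t.
move=> S x cS SX /isLub_inT Sx.
have /choice[F FP] : forall s, exists T : set L,
    S s -> [/\ countable T, T `<=` CL L & s = fsup T].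
  move=> s; have [Ss|nSs] := pselect (S s); last by exists set0.
  by have [T TP] := SX s Ss; exists T.
exists (\bigcup_(s in S) F s); split.
- by apply: bigcup_countable => // s /FP[].
- by move=> a [s /FP[_ + _]]; apply.
rewrite (isLub_fsup Sx); apply/le_anti/andP; split; apply: fsup_le.
  move=> s Ss; have [_ _ ->] := FP s Ss.
  by apply: fsup_le => t Ft; apply: fsup_ge; exists s.
move=> t [s Ss Ft]; apply: (le_trans _ (fsup_ge Ss)).
by have [_ _ ->] := FP s Ss; apply: fsup_ge.
Qed.

Record Lsigma_type := MkLsigma { Lsigma_val :> L; Lsigma_valP : Lsigma_val \in Lsigma }.
HB.instance Definition _ := [isSub for Lsigma_val].
HB.instance Definition _ := [Choice of Lsigma_type by <:].
HB.instance Definition _ :=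
  [SubChoice_isSubPOrder of Lsigma_type by <: with d].

Definition CL_to_Lsigma (c : CL_type L) : Lsigma_type :=
  MkLsigma (mem_set (CL_sub_Lsigma (set_mem (CL_valP c)))).

Definition BD0 := forall a : L, Lsigma a -> a^* `|` a^*^* = \top.

End Lsigma.

Arguments Lsigma {d} L _.

Definition is_sigma_frame {d} (A : tbLatticeType d) :=
  (forall S : set A, countable S -> exists s, isLub S s) /\
  (forall (S : set A) (s a : A), countable S -> isLub S s ->
     isLub [set a `&` y | y in S] (a `&` s)).

Definition CL_basic {d} (L : frameType d) := is_sigma_frame (CL_type L).

Definition sigma_complete {d} (B : ctbDistrLatticeType d) :=
  forall S : set B, countable S ->
    (exists s, isLub S s) /\
    (exists2 i, lbound S i & forall b, lbound S b -> b <= i).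

Definition has_left_adjoint {d d'} {A : porderType d} {B : porderType d'}
    (f : A -> B) :=
  exists g : B -> A, forall b a, (g b <= a) = (b <= f a).

Section DIdeals.
Context {d : Order.disp_t} {A : meetSemilatticeType d}.
Implicit Types (G E : set A) (s : A).

Definition admissible_join G s :=
  isLub G s /\ forall a, isLub [set a `&` y | y in G] (a `&` s).

Definition D_ideal E :=
  (forall a b, a <= b -> E b -> E a) /\
  (forall G s, G `<=` E -> admissible_join G s -> E s).

End DIdeals.

Section DinftyCL.
Context {d : Order.disp_t}.
Variable L : frameType d.

(* The frame of D-ideals of [CL], realized as a sublocale of [L]. *)
Definition DinftyCL : set L :=
  [set x | D_ideal [set c : CL_type L | CL_val c <= x]].

Lemma CL_sub_DinftyCL : CL L `<=` DinftyCL.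
Proof.
move=> x Cx; split=> [a b ab /=|G s Gx [[_ Gs] _] /=]; first exact: le_trans.
by have := Gs (MkCL (mem_set Cx)); apply=> g /Gx.
Qed.

Lemma DinftyCLI x y : DinftyCL x -> DinftyCL y -> DinftyCL (x `&` y).
Proof.
move=> [dx Dx] [dy Dy]; split=> [a b ab /=|G s Gxy Gs /=]; first exact: le_trans.
rewrite lexI; apply/andP; split; [apply: (Dx G) => // g|apply: (Dy G) => // g].
  by move=> /Gxy /=; rewrite lexI => /andP[].
by move=> /Gxy /=; rewrite lexI => /andP[].
Qed.

Definition DsigmaCL : set L := gen_sigma_frame DinftyCL (CL L).

End DinftyCL.

Arguments DinftyCL {d} L _.
Arguments DsigmaCL {d} L _.

(* Main.v *)
Require Import Defs.
From mathcomp Require Import all_boot all_order.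
From mathcomp Require Import boolp classical_sets.
From mathcomp Require Import cardinality.

(** All five conditions say the same thing: every [x] in [Lsigma L] has a
    least complemented upper bound ([CL_hull]).  Since an element of [Lsigma L]
    is exactly the join in [L] of a countable set [S] of complemented elements,
    and a complemented element bounds [S] iff it lies above that join, a least
    complemented upper bound of the join is the same thing as a supremum of [S]
    in [CL_type L] ([isLub_CLE]); and a choice of hulls is by definition a left
    adjoint of the embedding.

    The link with [BD0] is the pseudocomplement.  If [x^*^*] is complemented,
    it is the hull of [x], because complemented elements are fixed by double
    pseudocomplementation ([CL_hull_pcompl2]).  Conversely a hull [s] of [x]
    equals [x^*^*] ([CL_hullE]); this is where zero-dimensionality enters: [x^*]
    is a join of complemented elements [c], and [x] disjoint from [c] means that
    [x] lies below the complement of [c], so [s] does too.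

    Two facts complete the comparison.  Suprema in a Boolean algebra are
    automatically distributive ([isLub_meetl]), so completeness for countable
    sets already makes [CL_type L] a sigma-frame, and every supremum is
    admissible.  The latter makes a D-ideal contain the suprema in [CL_type L]
    of its subsets, so these suprema agree with those computed in [DinftyCL L],
    and [CL L] is closed under them. *)

Set Implicit Arguments.
Unset Strict Implicit.
Unset Printing Implicit Defensive.

Import Order.Theory.

Local Open Scope classical_set_scope.
Local Open Scope order_scope.

Section BooleanSuprema.
Context {d : Order.disp_t} {B : ctbDistrLatticeType d}.
Implicit Types (S : set B) (a b s : B).

(** Meeting with [a] is left adjoint to joining with the complement of [a],
    hence preserves every supremum that exists. *)
Lemma isLub_meetl S s a :
  isLub S s -> isLub [set a `&` y | y in S] (a `&` s).
Proof.
move=> [Ss sS]; split=> [_ [y Sy <-]|b ub]; first by rewrite leI2// Ss.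
have adj y : (a `&` y <= b) = (y <= ~` a `|` b).
  by rewrite meetC -leBLR diffE complK.
by rewrite adj; apply: sS => y Sy; rewrite -adj; apply: ub; exists y.
Qed.

Lemma admissible_isLub S s : isLub S s -> admissible_join S s.
Proof. by move=> Ss; split=> // a; apply: isLub_meetl. Qed.

(** De Morgan: the complement of the supremum of the complements is an
    infimum. *)
Lemma sigma_complete_sup :
  (forall S, countable S -> exists s, isLub S s) -> sigma_complete B.
Proof.
move=> sup S cS; split; first exact: sup.
have [|s [Ss sS]] := sup [set ~` x | x in S].
  exact: sub_countable (card_image_le _ _) cS.
exists (~` s) => [x Sx|b Sb].
  by rewrite -[x]complK leC; apply: Ss; exists x.
rewrite -[b]complK leC; apply: sS => _ [x Sx <-].
by rewrite leC; apply: Sb.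
Qed.

End BooleanSuprema.

Section Hull.
Context {d : Order.disp_t} {L : frameType d}.
Implicit Types (x y : L) (c s : CL_type L) (S : set (CL_type L)).

Lemma pcompl_anti x y : x <= y -> y^* <= x^*.
Proof.
move=> xy; rewrite le_pcompl -lex0 -(meet_pcompl y); exact: leI2.
Qed.

Lemma le_pcompl2 x : x <= x^*^*.
Proof. by rewrite le_pcompl meetC meet_pcompl. Qed.

Lemma pcompl3 x : x^*^*^* = x^*.
Proof. by apply/le_anti; rewrite le_pcompl2 pcompl_anti// le_pcompl2. Qed.

Lemma CL_val_CL c : CL L (CL_val c).
Proof. exact/set_mem/CL_valP. Qed.

Lemma CL_pcompl2 x : CL L x -> x^*^* = x.
Proof.
move=> /CL_pcomplP x1; apply/le_anti; rewrite le_pcompl2 andbT.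
by rewrite -[x^*^*]meetx1 -x1 meetUr (meetC _ x^*) meet_pcompl joinx0 leIr.
Qed.

(** [s] is the least complemented element above [x], in the form of the
    universal property that a left adjoint of the embedding has. *)
Definition CL_hull x s := forall c, (s <= c) = (x <= CL_val c).

Lemma CL_hull_ge x s : CL_hull x s -> x <= CL_val s.
Proof. by move=> <-. Qed.

(** A complemented [c] above [x] satisfies [x^*^* <= c^*^* = c]. *)
Lemma CL_hull_pcompl2 x (xC : CL L x^*^*) : CL_hull x (MkCL (mem_set xC)).
Proof.
move=> c; rewrite -CL_le_val /=; apply/idP/idP => [|xc].
  exact: le_trans (le_pcompl2 x).
by rewrite -(CL_pcompl2 (CL_val_CL c)) !pcompl_anti.
Qed.

(** The nontrivial half is that [s] is disjoint from [x^*].  Each complemented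
    [c] below [x^*] has a complement that lies above [x], hence above [s]. *)
Lemma CL_hullE x s : zero_dimensional L -> CL_hull x s -> CL_val s = x^*^*.
Proof.
move=> L0 hs; apply/le_anti/andP; split; last first.
  by rewrite -(CL_pcompl2 (CL_val_CL s)) !pcompl_anti// CL_hull_ge.
have [C CC xC] := L0 x^*.
rewrite le_pcompl meetC {1}xC meet_fsup -lex0; apply: fsup_le => _ [c Cc <-].
have xc : x <= c^* by rewrite le_pcompl meetC -le_pcompl xC fsup_ge.
have := hs (CL_compl (MkCL (mem_set (CC _ Cc)))).
by rewrite -CL_le_val /= xc le_pcompl meetC => /eqP ->.
Qed.

Lemma CL_hull_CL x s : zero_dimensional L -> CL_hull x s -> CL L x^*^*.
Proof. by move=> L0 /(CL_hullE L0) <-; apply: CL_val_CL. Qed.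

Lemma fsup_CL_le S c :
  (fsup [set CL_val a | a in S] <= CL_val c) <-> ubound S c.
Proof.
split=> [Sc a Sa|Sc]; last by apply: fsup_le => _ [a Sa <-]; apply: Sc.
by rewrite -CL_le_val; apply: le_trans Sc; apply: fsup_ge; exists a.
Qed.

(** The upper bounds of [S] among complemented elements are those of its join
    in [L], although that join need not be complemented. *)
Lemma isLub_CLE S s :
  isLub S s <-> CL_hull (fsup [set CL_val a | a in S]) s.
Proof.
split=> [[Ss sS] c|hs].
  apply/idP/idP => [sc|/fsup_CL_le]; last exact: sS.
  by apply/fsup_CL_le => a /Ss /le_trans; apply.
by split=> [|c /fsup_CL_le]; [apply/fsup_CL_le; rewrite -hs|rewrite hs].
Qed.

Lemma set_CLE (T : set L) :
  T `<=` CL L -> T = [set CL_val a | a in @CL_val _ L @^-1` T].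
Proof.
move=> TC; apply/seteqP; split=> [a Ta|_ [a Ta <-]//].
by exists (MkCL (mem_set (TC _ Ta))).
Qed.

Lemma countable_CL_preimage (T : set L) :
  countable T -> countable (@CL_val _ L @^-1` T).
Proof.
by apply: sub_countable; apply: card_ge_preimage => a b _ _; apply: val_inj.
Qed.

Lemma LsigmaP x :
  Lsigma L x <-> exists2 S, countable S & x = fsup [set CL_val a | a in S].
Proof.
rewrite LsigmaE; split=> [[S [cS SC ->]]|[S cS ->]]; last first.
  exists [set CL_val a | a in S]; split=> //; last first.
    by move=> _ [a _ <-]; apply: CL_val_CL.
  exact: sub_countable (card_image_le _ _) cS.
by exists (@CL_val _ L @^-1` S);
  [apply: countable_CL_preimage|rewrite -set_CLE].
Qed.

End Hull.

Section Equivalences.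
Context {d : Order.disp_t} {L : frameType d}.

Lemma isLub_CL_BD0 :
  BD0 L -> forall S : set (CL_type L), countable S -> exists s, isLub S s.
Proof.
move=> bd S cS; set x := fsup [set CL_val a | a in S].
have xC : CL L x^*^*.
  by apply/CLC/CL_pcomplP/bd/LsigmaP; exists S.
by exists (MkCL (mem_set xC)); apply/isLub_CLE/CL_hull_pcompl2.
Qed.

(** A supremum [s] in [CL_type L] bounds the supremum [x] in [DinftyCL L] from
    above because [s] itself lies in [DinftyCL L], and from below because [s] is
    an admissible join of elements of the D-ideal of [x]. *)
Lemma isLub_in_DinftyCL (S : set (CL_type L)) s x :
  isLub S s -> isLub_in (DinftyCL L) [set CL_val a | a in S] x ->
  x = CL_val s.
Proof.
move=> Ss [[_ Dx] Sx xS]; apply/le_anti/andP; split; last first.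
  apply: (Dx S); last exact: admissible_isLub.
  by move=> a Sa; apply: Sx; exists a.
apply: xS; first exact/CL_sub_DinftyCL/CL_val_CL.
by move=> _ [a Sa <-]; have [/(_ a Sa)] := Ss.
Qed.

Lemma DsigmaCL_CL : CL_basic L -> DsigmaCL L = CL L.
Proof.
move=> [sup _]; apply/seteqP; split; last exact: sub_gen_smallest.
apply: smallest_sub => //; split.
- exact: CL_sub_DinftyCL.
- exact: CL1.
- by move=> a b; apply: CLI.
move=> S x cS SC; rewrite (set_CLE SC) => Sx.
have [|s Ss] := sup (@CL_val _ L @^-1` S); first exact: countable_CL_preimage.
by rewrite (isLub_in_DinftyCL Ss Sx); apply: CL_val_CL.
Qed.

Lemma Boolz_Lsigma_CL :
  zero_dimensional L -> CL_basic L -> Boolz (Lsigma L) = CL L.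
Proof.
move=> L0 [sup _]; apply/seteqP; split=> [_ [x /LsigmaP[S cS ->] <-]|x xC].
  by have [s /isLub_CLE/(CL_hull_CL L0)] := sup S cS.
by exists x; [apply: CL_sub_Lsigma|apply: CL_pcompl2].
Qed.

Lemma sigma_complete_CL_Boolz :
  CL L = Boolz (Lsigma L) -> sigma_complete (CL_type L).
Proof.
move=> CLB; apply: sigma_complete_sup => S cS.
have xC : CL L (fsup [set CL_val a | a in S])^*^*.
  by rewrite CLB; exists (fsup [set CL_val a | a in S]) => //; apply/LsigmaP;
     exists S.
by exists (MkCL (mem_set xC)); apply/isLub_CLE/CL_hull_pcompl2.
Qed.

Lemma left_adjoint_CL_to_Lsigma :
  sigma_complete (CL_type L) -> has_left_adjoint (@CL_to_Lsigma d L).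
Proof.
move=> sc; suff /choice[g gP] : forall b : Lsigma_type L,
    exists s, CL_hull (Lsigma_val b) s.
  by exists g => b a; rewrite gP.
move=> b; have /LsigmaP[S cS ->] := set_mem (Lsigma_valP b).
by have [[s /isLub_CLE hs] _] := sc S cS; exists s.
Qed.

Lemma BD0_left_adjoint :
  zero_dimensional L -> has_left_adjoint (@CL_to_Lsigma d L) -> BD0 L.
Proof.
move=> L0 [g gP] a /mem_set aS; pose b := MkLsigma aS.
have /(CL_hull_CL L0) aC : CL_hull a (g b) by move=> c; rewrite gP.
by have /CL_pcomplP := aC; rewrite pcompl3 joinC.
Qed.

End Equivalences.

Theorem theorem6p16 (d : Order.disp_t) (L : frameType d)
    (L0 : zero_dimensional L) :
  [<-> BD0 L;
       CL_basic L;
       CL L = DsigmaCL L /\ DsigmaCL L = Boolz (Lsigma L);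
       sigma_complete (CL_type L);
       has_left_adjoint (@CL_to_Lsigma d L)].
Proof.
tfae.
- move=> bd; split; first exact: isLub_CL_BD0.
  by move=> S s a _; apply: isLub_meetl.
- by move=> basic; rewrite Boolz_Lsigma_CL// DsigmaCL_CL.
- by move=> [CD DB]; apply: sigma_complete_CL_Boolz; rewrite CD.
- exact: left_adjoint_CL_to_Lsigma.
- exact: BD0_left_adjoint.
Qed.
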